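(* Let $\mathcal{I}$ and $\mathcal{K}$ be ideals on $\omega$. Every sequential space is an $\mathcal{I}^{\mathcal{K}}$-sequential space.
   Context: $\omega$ is the set of natural numbers. An ideal on $\omega$ is a family of subsets of $\omega$ closed under finite unions and under taking subsets; throughout, ideals are assumed proper ($\omega$ is not a member) and to contain all finite subsets of $\omega$. $\mathcal{I}^*=\{A\subseteq \omega : \omega\setminus A\in\mathcal{I}\}$. A sequence $\{y_n\}_{n\in\omega}$ in a topological space $X$ is $\mathcal{K}$-convergent to $x\in X$ if $\{n : y_n\notin U\}\in\mathcal{K}$ for every neighborhood $U$ of $x$. A sequence $\{x_n\}_{n\in\omega}$ is $\mathcal{I}^{\mathcal{K}}$-convergent to $x$ if there is $M\in\mathcal{I}^*$ such that the sequence $y_n=x_n$ for $n\in M$, $y_n=x$ for $n\notin M$, is $\mathcal{K}$-convergent to $x$. A set $O\subseteq X$ is $\mathcal{I}^{\mathcal{K}}$-open if no sequence in $X\setminus O$ has an $\mathcal{I}^{\mathcal{K}}$-limit in $O$. $X$ is an $\mathcal{I}^{\mathcal{K}}$-sequential space if every $\mathcal{I}^{\mathcal{K}}$-open subset of $X$ is open. $X$ is a sequential space if every set $O\subseteq X$ such that no sequence in $X\setminus O$ converges (in the usual sense) to a point of $O$ is open. *)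

(* Defs.v *)
From mathcomp Require Import all_boot all_classical.
From mathcomp Require Import topology.

Set Implicit Arguments.
Unset Strict Implicit.
Unset Printing Implicit Defensive.

Local Open Scope classical_set_scope.

(* Proper ideals on omega containing every finite set. *)
Record is_ideal (I : set (set nat)) : Prop := IsIdeal {
  idealU : forall A B, I A -> I B -> I (A `|` B);
  ideal_sub : forall A B, A `<=` B -> I B -> I A;
  ideal_proper : ~ I [set: nat];
  ideal_finite : forall A, finite_set A -> I A
}.

Definition dual_filter (I : set (set nat)) : set (set nat) :=
  [set A | I (~` A)].

Section IKConvergence.
Variable X : topologicalType.
Implicit Types (I K : set (set nat)) (u : nat -> X) (x : X) (O : set X).

Definition ideal_cvg K u x : Prop :=
  forall U : set X, nbhs x U -> K [set n | ~ U (u n)].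

(* [patch (fun=> x) M u] is u on M and constantly x off M. *)
Definition IK_cvg I K u x : Prop :=
  exists2 M, dual_filter I M & ideal_cvg K (patch (fun=> x) M u) x.

Definition IK_open I K O : Prop :=
  forall u, (forall n, (~` O) (u n)) -> forall x, O x -> ~ IK_cvg I K u x.

Definition seq_open O : Prop :=
  forall u, (forall n, (~` O) (u n)) -> forall x, O x -> ~ (u @ \oo --> x).

End IKConvergence.

Definition IK_sequential_space (I K : set (set nat)) (X : topologicalType) :
    Prop :=
  forall O : set X, IK_open I K O -> open O.

Definition sequential_space (X : topologicalType) : Prop :=
  forall O : set X, seq_open O -> open O.

(* Main.v *)
Require Import Defs.
From mathcomp Require Import all_boot all_classical.
From mathcomp Require Import topology.

Local Open Scope classical_set_scope.

(** Usual convergence is stronger than $\mathcal{I}^{\mathcal{K}}$-convergence ([cvg_IK_cvg]), so an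
    $\mathcal{I}^{\mathcal{K}}$-open set, which excludes more limits, is sequentially open, hence
    open in a sequential space. *)

Lemma cvg_ideal_cvg (K : set (set nat)) (hK : is_ideal K)
    (X : topologicalType) (u : nat -> X) (x : X) :
  u @ \oo --> x -> ideal_cvg K u x.
Proof.
(* Past the rank [N] all terms lie in [U], so the exceptional indices form a subset of the finite
   set [I_N]. *)
move=> ux U /ux[N _ NU]; apply: (ideal_sub hK (B := `I_N)).
  by move=> n /= nU; rewrite ltnNge; apply/negP => /NU.
by apply: ideal_finite => //; exact: finite_II.
Qed.

Lemma cvg_IK_cvg (I K : set (set nat)) (hI : is_ideal I) (hK : is_ideal K)
    (X : topologicalType) (u : nat -> X) (x : X) :
  u @ \oo --> x -> IK_cvg I K u x.
Proof.
(* Taking $M=\omega$ leaves [u] unpatched, and its complement is empty, hence in [I]. *)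
move=> ux; exists setT.
  by rewrite /dual_filter /= setCT; apply: ideal_finite.
have -> : patch (fun=> x) setT u = u by apply/funext => n; rewrite patchT ?in_setT.
exact: cvg_ideal_cvg.
Qed.

Theorem theorem3p13 (I K : set (set nat)) (hI : is_ideal I) (hK : is_ideal K)
    (X : topologicalType) :
  sequential_space X -> IK_sequential_space I K X.
Proof.
move=> seqX O openO; apply: seqX => u uO x Ox ux.
by apply: (openO u uO x Ox); exact: cvg_IK_cvg.
Qed.
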